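(* Let $\Bbbk$ be an algebraically closed field of characteristic zero, $H$ a finite-dimensional Hopf algebra over $\Bbbk$, and $B\subseteq H$ a right coideal subalgebra. Then $B=H_\lambda$ for some partial action $\lambda:H\to\Bbbk$ if and only if $r_H(B)={}^{\mathrm{co}B^*}H^*$ contains a normalized right integral. This is in particular the case if $r_H(B)$ is semisimple.
   Context: A partial action of $H$ on $\Bbbk$ is a linear map $\lambda:H\to\Bbbk$ with $\lambda(1_H)=1$ and $\lambda(h)\lambda(k)=\lambda(h_1)\lambda(h_2k)$ for all $h,k\in H$ (Sweedler notation). For such $\lambda$, $H_\lambda:=\{\lambda(h_1)h_2\mid h\in H\}\subseteq H$ (identified with the partial smash product $\underline{\Bbbk\#H}$). A right coideal subalgebra of $H$ is a unital subalgebra $B$ with $\Delta(B)\subseteq B\otimes H$. For such $B$, $$r_H(B)={}^{\mathrm{co}B^*}H^*=\{\varphi\in H^*\mid\varphi(bh)=\varepsilon(b)\varphi(h)\text{ for all }b\in B,\ h\in H\},$$ which is a right coideal subalgebra of the dual Hopf algebra $H^*$ (with convolution product $(\varphi\psi)(h)=\varphi(h_1)\psi(h_2)$ and counit $\varepsilon_{H^*}(\varphi)=\varphi(1_H)$). A normalized right integral in $r_H(B)$ is an element $\lambda\in r_H(B)$ with $\lambda\psi=\varepsilon_{H^*}(\psi)\lambda$ for all $\psi\in r_H(B)$ and $\varepsilon_{H^*}(\lambda)=1$. *)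

(* Defs.v *)
From HB Require Import structures.
From mathcomp Require Import all_boot all_algebra all_field.

Set Implicit Arguments.
Unset Strict Implicit.
Unset Printing Implicit Defensive.

Import GRing.Theory.

Local Open Scope ring_scope.

(* The tensor product of two finite-dimensional spaces: the matrix t stands   *)
(* for the sum of the t i j *: (e_i (x) f_j), where e and f are the fixed     *)
(* bases vbasis {:U} and vbasis {:V}.                                         *)
Definition tensor (K : fieldType) (U V : vectType K) : Type :=
  'M[K]_(\dim {:U}, \dim {:V}).

HB.instance Definition _ (K : fieldType) (U V : vectType K) :=
  Vector.copy (tensor U V) 'M[K]_(\dim {:U}, \dim {:V}).

Section Tensor.

Variables (K : fieldType) (U V : vectType K).

Definition tens (u : U) (v : V) : tensor U V :=
  \matrix_(i, j) (coord (vbasis {:U}) i u * coord (vbasis {:V}) j v).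

(* For f bilinear this is the linear map on U (x) V sending u (x) v to f u v  *)
(* (tlift_tens, tlift_uniq).                                                  *)
Definition tlift (W : lmodType K) (f : U -> V -> W) (t : tensor U V) : W :=
  \sum_i \sum_j t i j *: f (vbasis {:U})`_i (vbasis {:V})`_j.

Definition tensv (A : {vspace U}) (B : {vspace V}) : {vspace tensor U V} :=
  <<[seq tens u v | u <- vbasis A, v <- vbasis B]>>%VS.

Lemma eq_tlift (W : lmodType K) (f g : U -> V -> W) t :
  (forall u v, f u v = g u v) -> tlift f t = tlift g t.
Proof.
by move=> fg; apply: eq_bigr => i _; apply: eq_bigr => j _; rewrite fg.
Qed.

Fact tlift_is_linear (W : lmodType K) (f : U -> V -> W) : linear (tlift f).
Proof.
move=> a s t; rewrite /tlift scaler_sumr -big_split /=; apply: eq_bigr => i _.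
rewrite scaler_sumr -big_split /=; apply: eq_bigr => j _.
by rewrite !mxE scalerDl scalerA.
Qed.

HB.instance Definition _ (W : lmodType K) (f : U -> V -> W) :=
  GRing.isLinear.Build K (tensor U V) W _ (tlift f) (tlift_is_linear f).

Lemma tlift_tens (W : lmodType K) (f : U -> V -> W) u v :
    (forall y, linear (f^~ y)) -> (forall x, linear (f x)) ->
  tlift f (tens u v) = f u v.
Proof.
move=> fl fr.
pose fL y : {linear U -> W} :=
  HB.pack (f^~ y) (GRing.isLinear.Build K U W *:%R (f^~ y) (fl y)).
pose fR x : {linear V -> W} :=
  HB.pack (f x) (GRing.isLinear.Build K V W *:%R (f x) (fr x)).
rewrite [u in RHS](coord_vbasis (memvf u)) -[RHS]/(fL v _) linear_sum.
apply: eq_bigr => i _; rewrite linearZ /= -[f _ v]/(fR _ v).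
rewrite [v in RHS](coord_vbasis (memvf v)) linear_sum scaler_sumr.
by apply: eq_bigr => j _; rewrite linearZ /= scalerA mxE.
Qed.

Lemma tlift_id (t : tensor U V) : tlift tens t = t.
Proof.
have tens_delta (i : 'I_(\dim {:U})) (j : 'I_(\dim {:V})) :
    tens (vbasis {:U})`_i (vbasis {:V})`_j = delta_mx i j :> 'M[K]_(_, _).
  apply/matrixP=> k l; rewrite !mxE !coord_free ?(basis_free (vbasisP _)) //.
  by rewrite -natrM mulnb ![_ == i]eq_sym ![_ == j]eq_sym.
rewrite [RHS]matrix_sum_delta; apply: eq_bigr => i _.
by apply: eq_bigr => j _; rewrite tens_delta.
Qed.

Lemma linear_tlift (W W' : lmodType K) (g : {linear W -> W'})
    (f : U -> V -> W) t : g (tlift f t) = tlift (fun u v => g (f u v)) t.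
Proof.
rewrite linear_sum; apply: eq_bigr => i _; rewrite linear_sum.
by apply: eq_bigr => j _; rewrite linearZ.
Qed.

Lemma tliftZ (W : lmodType K) k (f : U -> V -> W) t :
  k *: tlift f t = tlift (fun u v => k *: f u v) t.
Proof.
rewrite scaler_sumr; apply: eq_bigr => i _; rewrite scaler_sumr.
by apply: eq_bigr => j _; rewrite !scalerA mulrC.
Qed.

Lemma tlift_mull (c : K^o) (f : U -> V -> K^o) t :
  c * tlift f t = tlift (fun u v => c * f u v) t.
Proof. exact: (tliftZ c). Qed.

Lemma tlift_uniq (W : lmodType K) (g : {linear tensor U V -> W}) t :
  g t = tlift (fun u v => g (tens u v)) t.
Proof. by rewrite -linear_tlift tlift_id. Qed.

Lemma mem_tens (A : {vspace U}) (B : {vspace V}) :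
  {in A & B, forall u v, tens u v \in tensv A B}.
Proof.
have tensl v : linear (tens^~ v).
  by move=> k x y; apply/matrixP=> i j; rewrite !mxE linearP mulrDl mulrA.
have tensr u : linear (tens u).
  by move=> k x y; apply/matrixP=> i j; rewrite !mxE linearP mulrDr mulrCA.
pose L v : {linear U -> tensor U V} :=
  HB.pack (tens^~ v) (GRing.isLinear.Build K U _ *:%R (tens^~ v) (tensl v)).
pose R u : {linear V -> tensor U V} :=
  HB.pack (tens u) (GRing.isLinear.Build K V _ *:%R (tens u) (tensr u)).
move=> u v Au Bv; rewrite (coord_vbasis Au) -[tens _ v]/(L v _) linear_sum.
apply: memv_suml => i _; rewrite linearZ memvZ //= (coord_vbasis Bv).
rewrite -[tens _ _]/(R _ _) linear_sum; apply: memv_suml => j _.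
rewrite linearZ memvZ //= memv_span //.
apply/allpairsP; exists ((vbasis A)`_i, (vbasis B)`_j).
by split; rewrite ?mem_nth ?size_tuple.
Qed.

Lemma eq_tensv (A : {vspace U}) (B : {vspace V}) (W : lmodType K)
    (g g' : {linear tensor U V -> W}) :
    {in A & B, forall u v, g (tens u v) = g' (tens u v)} ->
  {in tensv A B, g =1 g'}.
Proof.
move=> eqg t; rewrite /tensv; set X := [seq _ | _ <- _, _ <- _].
rewrite -[X]/(tval (in_tuple X)) => /coord_span->; rewrite !linear_sum.
apply: eq_bigr => i _; rewrite !linearZ; congr (_ *: _).
have /allpairsP[[u v] /= [/vbasis_mem Au /vbasis_mem Bv ->]] : X`_i \in X.
  by rewrite mem_nth.
exact: eqg.
Qed.

End Tensor.

HB.mixin Record isCoalgebra (K : fieldType) C of Vector K C := {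
  comul : {linear C -> tensor C C};
  counit : {linear C -> K^o};
  (* both sides live in (C (x) C) (x) C *)
  comulA : forall x : C,
    tlift (fun a b => tlift (fun c d => tens (tens c d) b) (comul a)) (comul x)
    = tlift (fun a b => tlift (fun c d => tens (tens a c) d) (comul b))
            (comul x);
  counitl : forall x : C, tlift (fun a b => counit a *: b) (comul x) = x;
  counitr : forall x : C, tlift (fun a b => counit b *: a) (comul x) = x
}.

#[short(type="coalgType")]
HB.structure Definition Coalgebra (K : fieldType) :=
  { C of isCoalgebra K C & Vector K C }.

HB.mixin Record Coalgebra_isBialgebra (K : fieldType) H
    of Falgebra K H & Coalgebra K H := {
  counit1 : counit (1 : H) = 1;
  counitM : forall x y : H, counit (x * y) = counit x * counit y;
  comul1 : comul (1 : H) = tens 1 1;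
  comulM : forall x y : H, comul (x * y) =
    tlift (fun a b => tlift (fun c d => tens (a * c) (b * d)) (comul y))
          (comul x)
}.

#[short(type="bialgType")]
HB.structure Definition Bialgebra (K : fieldType) :=
  { H of Coalgebra_isBialgebra K H & Falgebra K H & Coalgebra K H }.

HB.mixin Record Bialgebra_isHopf (K : fieldType) H of Bialgebra K H := {
  antipode : {linear H -> H};
  antipodel : forall x : H,
    tlift (fun a b => antipode a * b) (comul x) = counit x *: (1 : H);
  antipoder : forall x : H,
    tlift (fun a b => a * antipode b) (comul x) = counit x *: (1 : H)
}.

#[short(type="hopfType")]
HB.structure Definition Hopf (K : fieldType) :=
  { H of Bialgebra_isHopf K H & Bialgebra K H }.

Section Sweedler.

Variables (K : fieldType) (C : coalgType K) (W : lmodType K).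

(* sweedler f h is f(h_1, h_2) in Sweedler notation, for f bilinear. *)
Definition sweedler (f : C -> C -> W) (h : C) : W := tlift f (comul h).

Fact sweedler_is_linear f : linear (sweedler f).
Proof. by move=> a x y; rewrite /sweedler !linearP. Qed.

HB.instance Definition _ f :=
  GRing.isLinear.Build K C W _ (sweedler f) (sweedler_is_linear f).

End Sweedler.

Definition dual (K : fieldType) (V : vectType K) : Type := 'Hom(V, K^o).

HB.instance Definition _ (K : fieldType) (V : vectType K) :=
  Vector.copy (dual V) 'Hom(V, K^o).

Section DualAlgebra.

Variables (K : fieldType) (H : bialgType K).

Implicit Types phi psi chi : dual H.

Definition dual_one : dual H := linfun counit.

Definition dual_mul phi psi : dual H :=
  linfun (sweedler (fun a b => phi a * psi b : K^o)).

Lemma dual_mulE phi psi h :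
  dual_mul phi psi h = sweedler (fun a b => phi a * psi b : K^o) h.
Proof. exact: lfunE. Qed.

Lemma dual_oneE h : dual_one h = counit h.
Proof. exact: lfunE. Qed.

Fact dual_mulA : associative dual_mul.
Proof.
move=> phi psi chi; apply/lfunP=> h; rewrite !dual_mulE /sweedler.
pose g2 : {linear tensor H H -> K^o} := tlift (fun c d => phi c * psi d : K^o).
pose g : {linear tensor (tensor H H) H -> K^o} :=
  tlift (fun t b => g2 t * chi b : K^o).
have gE c d b : g (tens (tens c d) b) = phi c * psi d * chi b.
  rewrite [LHS]tlift_tens => [|x k u v|x k u v].
  - rewrite [g2 _]tlift_tens // => x k u v.
      by rewrite linearP mulrDl scalerAl.
    by rewrite linearP mulrDr scalerAr.
  - by rewrite linearP mulrDl scalerAl.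
  by rewrite linearP mulrDr scalerAr.
have /(congr1 g) := comulA h; rewrite !(linear_tlift g) => eqg.
apply: etrans (etrans (esym eqg) _); apply: eq_tlift => a b.
  rewrite dual_mulE (linear_tlift g) /sweedler tlift_mull.
  by apply: eq_tlift => c d; rewrite gE mulrA.
rewrite dual_mulE (linear_tlift g) [RHS]mulrC /sweedler tlift_mull.
by apply: eq_tlift => c d; rewrite gE; exact: mulrC.
Qed.

Fact dual_mul1l : left_id dual_one dual_mul.
Proof.
move=> phi; apply/lfunP=> h; rewrite dual_mulE -[in RHS](counitl h).
rewrite linear_tlift; apply: eq_tlift => a b.
by rewrite dual_oneE linearZ.
Qed.

Fact dual_mul1r : right_id dual_one dual_mul.
Proof.
move=> phi; apply/lfunP=> h; rewrite dual_mulE -[in RHS](counitr h).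
rewrite linear_tlift; apply: eq_tlift => a b.
by rewrite dual_oneE linearZ mulrC.
Qed.

Fact dual_mulDl : left_distributive dual_mul +%R.
Proof.
move=> phi psi chi; apply/lfunP=> h; rewrite add_lfunE !dual_mulE.
rewrite /sweedler /tlift -big_split; apply: eq_bigr => i _ /=.
rewrite -big_split; apply: eq_bigr => j _ /=.
by rewrite add_lfunE mulrDl scalerDr.
Qed.

Fact dual_mulDr : right_distributive dual_mul +%R.
Proof.
move=> phi psi chi; apply/lfunP=> h; rewrite add_lfunE !dual_mulE.
rewrite /sweedler /tlift -big_split; apply: eq_bigr => i _ /=.
rewrite -big_split; apply: eq_bigr => j _ /=.
by rewrite add_lfunE mulrDr scalerDr.
Qed.

Fact dual_one_neq0 : dual_one != 0.
Proof.
apply/eqP=> /lfunP/(_ 1); rewrite dual_oneE counit1 zero_lfunE => /eqP.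
by rewrite oner_eq0.
Qed.

HB.instance Definition _ := GRing.Zmodule_isNzRing.Build (dual H)
  dual_mulA dual_mul1l dual_mul1r dual_mulDl dual_mulDr dual_one_neq0.

Fact dual_scaleAl (k : K) (phi psi : dual H) :
  k *: (phi * psi) = (k *: phi) * psi.
Proof.
apply/lfunP=> h; rewrite scale_lfunE !dual_mulE tliftZ.
by apply: eq_tlift => a b; rewrite scale_lfunE scalerAl.
Qed.

HB.instance Definition _ := GRing.Lmodule_isLalgebra.Build K (dual H)
  dual_scaleAl.

Fact dual_scaleAr (k : K) (phi psi : dual H) :
  k *: (phi * psi) = phi * (k *: psi).
Proof.
apply/lfunP=> h; rewrite scale_lfunE !dual_mulE tliftZ.
by apply: eq_tlift => a b; rewrite scale_lfunE scalerAr.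
Qed.

HB.instance Definition _ := GRing.Lalgebra_isAlgebra.Build K (dual H)
  dual_scaleAr.

HB.instance Definition _ := Algebra_isFalgebra.Build K (dual H).

(* The counit of the dual Hopf algebra. *)
Definition dual_counit (phi : dual H) : K := phi 1.

End DualAlgebra.

Section PartialActions.

Variables (K : fieldType) (H : hopfType K).

Definition partial_action (lam : dual H) : Prop :=
  lam 1 = 1 /\
  (forall h k : H,
     lam h * lam k = sweedler (fun a b => lam a * lam (b * k) : K^o) h).

(* H_lam, the image of h |-> lam(h_1) h_2. *)
Definition partial_smash (lam : dual H) : {vspace H} :=
  limg (linfun (sweedler (fun a b : H => (lam a : K) *: b))).

Lemma partial_smashP (lam : dual H) x :
  reflect (exists h, x = sweedler (fun a b => (lam a : K) *: b) h)
          (x \in partial_smash lam).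
Proof.
apply: (iffP memv_imgP) => [[h _ ->]|[h ->]].
  by exists h; rewrite lfunE.
by exists h; rewrite ?memvf ?lfunE.
Qed.

Definition right_coideal_subalgebra (B : {vspace H}) : Prop :=
  [/\ 1 \in B, {in B &, forall x y, x * y \in B}
    & {in B, forall x, comul x \in tensv B {:H}}].

Definition coinv_dual_map (b h : H) (phi : dual H) : K^o :=
  phi (b * h) - counit b * phi h.

Fact coinv_dual_map_is_linear b h : linear (coinv_dual_map b h).
Proof.
move=> k phi psi; rewrite /coinv_dual_map !add_lfunE !scale_lfunE.
by rewrite mulrDr opprD addrACA scalerBr scalerAr.
Qed.

HB.instance Definition _ b h :=
  GRing.isLinear.Build K (dual H) K^o _ (coinv_dual_map b h)
    (coinv_dual_map_is_linear b h).

(* r_H(B); the defining condition is imposed on bases of B and H, which is    *)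
(* the same by bilinearity (mem_rH).                                          *)
Definition rH (B : {vspace H}) : {vspace dual H} :=
  (\bigcap_(b <- vbasis B) \bigcap_(h <- vbasis {:H})
     lker (linfun (coinv_dual_map b h)))%VS.

Lemma mem_rH (B : {vspace H}) (phi : dual H) :
  phi \in rH B <-> {in B, forall b h, phi (b * h) = counit b * phi h}.
Proof.
have -> : phi \in rH B = all (fun b => all (fun h =>
    phi (b * h) == counit b * phi h) (vbasis {:H})) (vbasis B).
  rewrite /rH; elim: {B}(tval (vbasis B)) => [|b s IHs] /=.
    by rewrite big_nil memvf.
  rewrite big_cons memv_cap IHs; congr (_ && _).
  elim: {IHs}(tval (vbasis {:H})) => [|h r IHr] /=.
    by rewrite big_nil memvf.
  by rewrite big_cons memv_cap IHr memv_ker lfunE /= subr_eq0.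
split=> [/allP phiB b Bb h | phiB]; last first.
  apply/allP=> b Bb; apply/allP=> h _; apply/eqP/phiB; exact: vbasis_mem.
rewrite {1}(coord_vbasis Bb) [in counit b](coord_vbasis Bb).
rewrite mulr_suml !linear_sum mulr_suml; apply: eq_bigr => i _.
rewrite -scalerAl !linearZ /= -[RHS]scalerAl; congr (_ *: _).
have /phiB/allP phiBi : (vbasis B)`_i \in vbasis B.
  by rewrite mem_nth ?size_tuple.
rewrite {1 2}(coord_vbasis (memvf h)) mulr_sumr !linear_sum mulr_sumr.
apply: eq_bigr => j _; rewrite -scalerAr !linearZ /= -[RHS]scalerAr.
by congr (_ *: _); apply/eqP/phiBi; rewrite mem_nth ?size_tuple.
Qed.

Lemma rH_subalgebra (B : {vspace H}) : right_coideal_subalgebra B ->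
  1 \in rH B /\ {in rH B &, forall phi psi, phi * psi \in rH B}.
Proof.
case=> _ _ DB; split; first by apply/mem_rH=> b _ h; rewrite !dual_oneE counitM.
move=> phi psi /mem_rH phiB /mem_rH psiB; apply/mem_rH=> b Bb h.
rewrite [LHS]dual_mulE [(phi * psi) h]dual_mulE /sweedler comulM.
pose F : {linear tensor H H -> K^o} := tlift (fun a c => phi a * psi c : K^o).
have FE a c : F (tens a c) = phi a * psi c.
  rewrite [LHS]tlift_tens // => x k u v.
    by rewrite linearP mulrDl scalerAl.
  by rewrite linearP mulrDr scalerAr.
rewrite -/F (linear_tlift F).
pose G1 : {linear tensor H H -> K^o} := tlift (fun a c =>
  tlift (fun d e => phi (a * d) * psi (c * e) : K^o) (comul h)).
pose X c : K^o := tlift (fun d e => phi d * psi (c * e) : K^o) (comul h).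
pose G2 : {linear tensor H H -> K^o} :=
  tlift (fun a c => counit a * X c : K^o).
have Xlin : linear X.
  move=> k u v; rewrite /X tliftZ /tlift -big_split; apply: eq_bigr => i _ /=.
  rewrite -big_split; apply: eq_bigr => j _ /=; rewrite -scalerDr.
  by congr (_ *: _); rewrite mulrDl -scalerAl linearP mulrDr scalerAr.
pose XL : {linear H -> K^o} :=
  HB.pack X (GRing.isLinear.Build K H K^o *:%R X Xlin).
have -> : tlift (fun u v =>
    F (tlift (fun c d => tens (u * c) (v * d)) (comul h))) (comul b)
  = G1 (comul b).
  apply: eq_tlift => u v; rewrite (linear_tlift F).
  by apply: eq_tlift => d e; rewrite FE.
have -> : G1 (comul b) = G2 (comul b).
  apply: (eq_tensv _ (DB b Bb)) => u v Bu _; rewrite [LHS]tlift_tens; first last.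
  - move=> x k y z; rewrite tliftZ /tlift -big_split; apply: eq_bigr => i _ /=.
    rewrite -big_split; apply: eq_bigr => j _ /=; rewrite -scalerDr.
    by congr (_ *: _); rewrite mulrDl -scalerAl linearP mulrDr scalerAr.
  - move=> x k y z; rewrite tliftZ /tlift -big_split; apply: eq_bigr => i _ /=.
    rewrite -big_split; apply: eq_bigr => j _ /=; rewrite -scalerDr.
    by congr (_ *: _); rewrite mulrDl -scalerAl linearP mulrDl scalerAl.
  rewrite [RHS]tlift_tens; first last.
  - by move=> x k y z; rewrite Xlin mulrDr scalerAr.
  - by move=> x k y z; rewrite linearP mulrDl scalerAl.
  rewrite /X tlift_mull; apply: eq_tlift => d e.
  by rewrite phiB // mulrA.
have -> : G2 (comul b) = XL b.
  rewrite -[in RHS](counitl b) (linear_tlift XL); apply: eq_tlift => a c.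
  by rewrite linearZ.
rewrite tlift_mull; apply: eq_tlift => d e.
by rewrite psiB // mulrCA.
Qed.

Definition normalized_right_integral (A : {vspace dual H}) (lam : dual H) :
    Prop :=
  [/\ lam \in A, {in A, forall psi, lam * psi = dual_counit psi *: lam}
    & dual_counit lam = 1].

End PartialActions.

Section Semisimple.

Variables (K : fieldType) (aT : falgType K) (A : {vspace aT}).

Definition left_ideal (I : {vspace aT}) : Prop :=
  (I <= A)%VS /\ (A * I <= I)%VS.

Definition simple_left_ideal (I : {vspace aT}) : Prop :=
  [/\ left_ideal I, I <> 0%VS
    & forall J, left_ideal J -> (J <= I)%VS -> J = 0%VS \/ J = I].

(* For a subalgebra A: the left regular A-module is a (finite) direct sum of  *)
(* simple submodules.                                                         *)
Definition semisimple_subalgebra : Prop :=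
  exists n (I : 'I_n -> {vspace aT}),
    [/\ forall i, simple_left_ideal (I i), directv (\sum_i I i)
      & A = (\sum_i I i)%VS].

End Semisimple.

(* Main.v *)
(* Forward, lam(h_1)h_2 ranges over H_lam, so the partial action identity     *)
(* says that lam lies in r_H(H_lam) and is a right integral there. Backward,  *)
(* a normalized right integral lam of R = r_H(B) satisfies the identity       *)
(* because R contains the translates lam(-k). Then A = H_lam is a right       *)
(* coideal subalgebra containing B, and A^+H = B^+H. The point is that this   *)
(* forces A = B.                                                              *)
(*                                                                            *)
(* It suffices that dim H = dim B (dim H - dim B^+H) for every right coideal  *)
(* subalgebra B. Among the right ideals Q <> B of B choose R with the largest *)
(* ratio (dim H - dim QH) / (dim B - dim Q) and then of least dimension. This *)
(* ratio bounds, for B-stable subspaces X0 <= X of a right H-module, the      *)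
(* codimension of X0 H in XH by that of X0 in X. For X = B (x) H, with H      *)
(* acting on the left factor, and X0 the image of R (x) H under the bijection *)
(* x (x) h |-> x_1 (x) x_2 h the bound is attained, hence so is the ratio by  *)
(* the transporter of 1 (x) h into X0. Minimality of R gives R (x) H <= X0,   *)
(* with equality by dimension, so R is costable; therefore R = 0 or RH = H,   *)
(* and RH = H has ratio 0. So R = 0, which gives one inequality, and the      *)
(* bound for B^+ in H gives the other. This is a variant of Skryabin's        *)
(* argument for the freeness of H over B.                                     *)

Require Import Defs.
From HB Require Import structures.
From mathcomp Require Import all_boot all_algebra all_field.
From mathcomp Require Import zify.
From Stdlib Require Import Classical.

Set Implicit Arguments.
Unset Strict Implicit.
Unset Printing Implicit Defensive.

Import GRing.Theory.

Local Open Scope ring_scope.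

(** * Dimensions and spans *)

(** In the code B^+ is [augmentation B] and QH is [mulH Q]. The forward direction is
    [partial_action_integral]. For the converse, the integral property applied to translates
    ([integral_smash]) gives the partial action law as well as the inclusion of A^+H in B^+H for A =
    [partial_smash lam]. Equality of A and B is then a count of dimensions
    ([eq_coideal_subalgebra]): [dim_right_ideal_mulH] and [dim_mulH_augmentation] are the two halves
    of dim H = dim B (dim H - dim B^+H), so B^+H determines dim B.

    The semisimple case rests on [semisimple_right_integral]: in a semisimple algebra with a
    character, a complement of the kernel of the character contains a normalized integral. It is
    applied to r_H(B) with the character psi |-> psi(1). *)

Definition linear_fun (K : fieldType) (U V : lmodType K) (f : U -> V)
    (lf : linear f) : {linear U -> V} :=
  HB.pack f (GRing.isLinear.Build K U V *:%R f lf).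

Section Dimensions.

Variables (K : fieldType) (U V : vectType K).

Lemma dim_limg_sub (f : 'Hom(U, V)) (S T : {vspace U}) : (S <= T)%VS ->
  (\dim (f @: T) + \dim S <= \dim T + \dim (f @: S))%N.
Proof.
move=> ST; rewrite -(limg_ker_dim f T) -(limg_ker_dim f S).
have := dimvS (capvS ST (subvv (lker f))); lia.
Qed.

Lemma dim_limg_ker (f : 'Hom(U, V)) (S T : {vspace U}) : (S <= T)%VS ->
    (T :&: lker f <= S)%VS ->
  (\dim (f @: T) + \dim S = \dim T + \dim (f @: S))%N.
Proof.
move=> ST kS; rewrite -(limg_ker_dim f T) -(limg_ker_dim f S).
suff -> : (S :&: lker f = T :&: lker f)%VS by lia.
by apply/eqP; rewrite eqEsubv capvS //= subv_cap kS capvSr.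
Qed.

Lemma functional_separation (W : {vspace U}) (x : U) : x \notin W ->
  exists2 phi : {linear U -> K^o}, {in W, forall w, phi w = 0} & phi x != 0.
Proof.
move=> xW; pose p : 'End(U) := \1%VF - projv W.
have px0 : p x != 0.
  apply: contraNneq xW => /eqP; rewrite add_lfunE opp_lfunE id_lfunE subr_eq0.
  by move=> /eqP->; rewrite memv_proj.
have [i ci] : exists i, coord (vbasis {:U}) i (p x) != 0.
  apply/existsP; apply: contraNT px0 => /existsPn ci.
  rewrite (coord_vbasis (memvf (p x))) big1 // => i _.
  by move/negPn: (ci i) => /eqP->; rewrite scale0r.
exists (coord (vbasis {:U}) i \o p : {linear U -> K^o}) => //= w Ww.
by rewrite add_lfunE opp_lfunE id_lfunE projv_id // subrr linear0.
Qed.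

End Dimensions.

Section Bispan.

Variables (K : fieldType) (U V W : vectType K) (f : U -> V -> W).

(** One construction serves for QH in H, for XH in a right module, and for [tensv], to which it
    unfolds when f is [tens]. *)
Definition bispan (X : {vspace U}) (Y : {vspace V}) : {vspace W} :=
  <<[seq f x y | x <- vbasis X, y <- vbasis Y]>>%VS.

Lemma bispan_subv (X : {vspace U}) (Y : {vspace V}) (Z : {vspace W}) :
  {in X & Y, forall x y, f x y \in Z} -> (bispan X Y <= Z)%VS.
Proof.
move=> fZ; apply/span_subvP => _ /allpairsP[[x y] /= [Xx Yy ->]].
by apply: fZ; exact: vbasis_mem.
Qed.

Lemma dim_bispan (X : {vspace U}) (Y : {vspace V}) :
  (\dim (bispan X Y) <= \dim X * \dim Y)%N.
Proof.
by apply: leq_trans (dim_span _) _; rewrite size_allpairs !size_tuple.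
Qed.

Hypothesis fl : forall y, linear (f^~ y).
Hypothesis fr : forall x, linear (f x).

Lemma mem_bispan (X : {vspace U}) (Y : {vspace V}) :
  {in X & Y, forall x y, f x y \in bispan X Y}.
Proof.
move=> u v Xu Yv.
rewrite (coord_vbasis Xu) -[f _ v]/(linear_fun (fl v) _) linear_sum.
apply: memv_suml => i _; rewrite linearZ memvZ //= (coord_vbasis Yv).
rewrite -[f _ _]/(linear_fun (fr _) _) linear_sum; apply: memv_suml => j _.
rewrite linearZ memvZ //= memv_span //.
apply/allpairsP; exists ((vbasis X)`_i, (vbasis Y)`_j).
by split; rewrite ?mem_nth ?size_tuple.
Qed.

End Bispan.

(** * Ratios of codimensions over right ideals *)

Section RelativeRank.

Variables (K : fieldType) (H : falgType K) (B : {vspace H}).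
Hypothesis BM : {in B &, forall x y, x * y \in B}.

Definition right_ideal (Q : {vspace H}) : Prop :=
  (Q <= B)%VS /\ {in Q & B, forall x b, x * b \in Q}.

Definition mulH (Q : {vspace H}) : {vspace H} := @bispan K H H H *%R Q {:H}.

Lemma mulr_linearl (y : H) : linear ( *%R^~ y : H -> H).
Proof. by move=> k u v; rewrite mulrDl scalerAl. Qed.

Lemma mulr_linearr (x : H) : linear ( *%R x : H -> H).
Proof. by move=> k u v; rewrite mulrDr scalerAr. Qed.

Variables a c : nat.
(** The ratio of the codimension of QH in H to that of Q in B is at most a/c, cleared of
    denominators and of truncated subtraction. *)
Hypothesis ratioP : forall Q, right_ideal Q ->
  (c * \dim {:H} + a * \dim Q <= a * \dim B + c * \dim (mulH Q))%N.

Variables (Z : vectType K) (act : Z -> H -> Z).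
Hypothesis actl : forall h, linear (act^~ h).
Hypothesis actr : forall z, linear (act z).
Hypothesis act1 : forall z, act z 1 = z.
Hypothesis actM : forall z x y, act z (x * y) = act (act z x) y.

Notation actH X := (bispan act X {:H}).

Definition act_stable (X : {vspace Z}) : Prop :=
  {in X & B, forall x b, act x b \in X}.

Definition orbit_map (z : Z) : 'Hom(H, Z) := linfun (linear_fun (actr z)).

Lemma orbit_mapE z h : orbit_map z h = act z h.
Proof. exact: lfunE. Qed.

Lemma act_addl z z' h : act (z + z') h = act z h + act z' h.
Proof. by have := actl h 1 z z'; rewrite !scale1r. Qed.

Definition transporter (X : {vspace Z}) (z : Z) : {vspace H} :=
  (B :&: (orbit_map z @^-1: X))%VS.

Lemma mem_transporter X z b :
  (b \in transporter X z) = (b \in B) && (act z b \in X).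
Proof. by rewrite memv_cap -memv_preim orbit_mapE. Qed.

Lemma transporter_ideal X z : act_stable X -> right_ideal (transporter X z).
Proof.
move=> sX; split=> [|q b]; first exact: capvSl.
rewrite !mem_transporter => /andP[Bq zq] Bb.
by rewrite BM //= actM sX.
Qed.

Lemma add_orbit_stable X z : act_stable X ->
  act_stable (X + orbit_map z @: B)%VS.
Proof.
move=> sX _ b /memv_addP[x Xx [_ /memv_imgP[c' Bc' ->] ->]] Bb.
by rewrite act_addl orbit_mapE -actM memv_add ?sX // -orbit_mapE memv_img // BM.
Qed.

(** The map b |-> zb induces an isomorphism from B/Q onto (X + zB)/X, where Q is the transporter. *)
Lemma dim_add_orbit X z :
  (\dim (X + orbit_map z @: B) + \dim (transporter X z)
   = \dim X + \dim B)%N.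
Proof.
set f := orbit_map z; set Q := transporter X z.
have QB : (Q <= B)%VS by apply: capvSl.
have fQ : (f @: Q = X :&: f @: B)%VS.
  apply/eqP; rewrite eqEsubv subv_cap limgS // andbT; apply/andP; split.
    apply/subvP=> _ /memv_imgP[q Qq ->].
    by move: Qq; rewrite mem_transporter -orbit_mapE => /andP[].
  apply/subvP=> y /memv_capP[Xy /memv_imgP[b Bb yE]].
  by rewrite yE memv_img // mem_transporter Bb -orbit_mapE -yE.
have kQ : (B :&: lker f <= Q)%VS.
  apply/subvP=> b; rewrite memv_cap mem_transporter memv_ker -orbit_mapE.
  by case/andP=> -> /eqP->; rewrite mem0v.
have := dim_limg_ker QB kQ; rewrite fQ; have := dimv_sum_cap X (f @: B); lia.
Qed.

(** (X + zB)H lies in XH + zH, and XH already contains z(QH); passing from QH to H under h |-> zh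
    adds at most dim H - dim QH. *)
Lemma dim_actH_add_orbit X z :
  (\dim (actH (X + orbit_map z @: B)) + \dim (mulH (transporter X z))
   <= \dim (actH X) + \dim {:H})%N.
Proof.
set f := orbit_map z; set Q := transporter X z.
have sub1 : (actH (X + f @: B) <= actH X + limg f)%VS.
  apply: bispan_subv => _ h /memv_addP[x Xx [_ /memv_imgP[b Bb ->] ->]] _.
  rewrite act_addl [f b]orbit_mapE -actM -[act z _]orbit_mapE.
  apply: memv_add; last by rewrite memv_img ?memvf.
  by apply: (mem_bispan actl actr); rewrite ?memvf.
have sub2 : (f @: mulH Q <= actH X :&: limg f)%VS.
  rewrite subv_cap limgS ?subvf // andbT; apply/subvP=> _ /memv_imgP[y Qy ->].
  rewrite memv_preim; move: y Qy; apply/subvP/bispan_subv => q h Qq _.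
  rewrite -memv_preim orbit_mapE actM.
  apply: (mem_bispan actl actr); rewrite ?memvf //.
  by move: Qq; rewrite mem_transporter => /andP[].
have := dimvS sub1; have := dimvS sub2; have := dimv_sum_cap (actH X) (limg f).
have := dim_limg_sub f (subvf (mulH Q)); lia.
Qed.

Hypothesis B1 : 1 \in B.

(* Passing from X0 to X0 + zB enlarges the quotient by B/Q, where Q is the    *)
(* transporter of z into X0, and the span by at most dim H - dim QH.          *)
Lemma relative_rank_bound (X0 X : {vspace Z}) :
    act_stable X0 -> act_stable X -> (X0 <= X)%VS ->
  (c * \dim (actH X) + a * \dim X0 <= a * \dim X + c * \dim (actH X0))%N.
Proof.
have [n] := ubnP (\dim X - \dim X0); elim: n X0 => // n IHn X0 le_n s0 sX X0X.
have [XX0|/subvPn[z Xz X0z]] := boolP (X <= X0)%VS.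
  have -> : X0 = X by apply/eqP; rewrite eqEsubv X0X.
  by rewrite addnC.
set X1 := (X0 + orbit_map z @: B)%VS.
have X1z : z \in X1.
  rewrite -[z]act1 -orbit_mapE; apply: (subvP (addvSr _ _)).
  exact: memv_img.
have X1X : (X1 <= X)%VS.
  rewrite subv_add X0X; apply/subvP=> _ /memv_imgP[b Bb ->].
  by rewrite orbit_mapE sX.
have lt01 : (\dim X0 < \dim X1)%N.
  rewrite ltnNge; apply: contra X0z => le10.
  have -> : X0 = X1 by apply/eqP; rewrite eqEdim addvSl.
  exact: X1z.
have := IHn X1 _ (add_orbit_stable s0) sX X1X.
have := dimvS X1X; have := ratioP (transporter_ideal z s0).
have := dim_add_orbit X0 z; have := dim_actH_add_orbit X0 z.
by rewrite -/X1; nia.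
Qed.

End RelativeRank.

(** * Sweedler calculus *)

Section Linearity.

Variable K : fieldType.

Lemma lin_id (U : lmodType K) : linear (fun x : U => x).
Proof. by []. Qed.

Lemma lin_comp (U V W : lmodType K) (g : {linear V -> W}) (f : U -> V) :
  linear f -> linear (fun x => g (f x)).
Proof. by move=> lf k u v; rewrite lf linearP. Qed.

Lemma lin_mull (U : lmodType K) (A : algType K) (f : U -> A) (y : A) :
  linear f -> linear (fun x => f x * y).
Proof. by move=> lf k u v; rewrite lf mulrDl scalerAl. Qed.

Lemma lin_mulr (U : lmodType K) (A : algType K) (f : U -> A) (y : A) :
  linear f -> linear (fun x => y * f x).
Proof. by move=> lf k u v; rewrite lf mulrDr scalerAr. Qed.

Lemma lin_scalel (U V : lmodType K) (f : U -> K^o) (y : V) :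
  linear f -> linear (fun x => (f x : K) *: y).
Proof. by move=> lf k u v; rewrite lf scalerDl -scalerA. Qed.

Lemma lin_scaler (U V : lmodType K) (f : U -> V) (k : K) :
  linear f -> linear (fun x => k *: f x).
Proof. by move=> lf l u v; rewrite lf scalerDr !scalerA mulrC. Qed.

Lemma lin_tensl (U : lmodType K) (V W : vectType K) (f : U -> V) (y : W) :
  linear f -> linear (fun x => tens (f x) y).
Proof.
by move=> lf k u v; apply/matrixP=> i j; rewrite !mxE lf linearP mulrDl mulrA.
Qed.

Lemma lin_tensr (U : lmodType K) (V W : vectType K) (f : U -> W) (y : V) :
  linear f -> linear (fun x => tens y (f x)).
Proof.
move=> lf k u v; apply/matrixP=> i j.
by rewrite !mxE lf linearP mulrDr mulrCA.
Qed.

Lemma lin_tlift (U : lmodType K) (V V' : vectType K) (W : lmodType K)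
    (F : U -> V -> V' -> W) t :
  (forall a b, linear (fun z => F z a b)) -> linear (fun z => tlift (F z) t).
Proof.
move=> lF k u v; rewrite /tlift scaler_sumr -big_split; apply: eq_bigr => i _.
rewrite scaler_sumr -big_split; apply: eq_bigr => j _ /=.
by rewrite lF scalerDr !scalerA mulrC.
Qed.

Lemma lin_sweedler (U : lmodType K) (H : coalgType K) (W : lmodType K)
    (F : U -> H -> H -> W) x :
  (forall a b, linear (fun z => F z a b)) ->
  linear (fun z => sweedler (F z) x).
Proof. exact: lin_tlift. Qed.

Lemma tlift_exchange (U U' V V' : vectType K) (W : lmodType K)
    (f : U -> U' -> V -> V' -> W) s t :
  tlift (fun a b => tlift (fun c d => f a b c d) t) s
  = tlift (fun c d => tlift (fun a b => f a b c d) s) t.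
Proof.
rewrite /tlift.
transitivity (\sum_i \sum_k \sum_j \sum_l s i j *: (t k l *:
    f (vbasis {:U})`_i (vbasis {:U'})`_j (vbasis {:V})`_k (vbasis {:V'})`_l)).
  apply: eq_bigr => i _; rewrite exchange_big; apply: eq_bigr => j _ /=.
  by rewrite scaler_sumr; apply: eq_bigr => k _; rewrite scaler_sumr.
rewrite exchange_big; apply: eq_bigr => k _ /=.
transitivity (\sum_i \sum_l \sum_j s i j *: (t k l *:
    f (vbasis {:U})`_i (vbasis {:U'})`_j (vbasis {:V})`_k (vbasis {:V'})`_l)).
  by apply: eq_bigr => i _; rewrite exchange_big.
rewrite exchange_big; apply: eq_bigr => l _ /=.
rewrite scaler_sumr; apply: eq_bigr => i _; rewrite scaler_sumr.
by apply: eq_bigr => j _; rewrite !scalerA mulrC.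
Qed.

Lemma tensv_img (U V W : vectType K) (A : {vspace U}) (B : {vspace V})
    (Z : {vspace W}) (g : {linear tensor U V -> W}) :
    {in A & B, forall u v, g (tens u v) \in Z} ->
  {in tensv A B, forall t, g t \in Z}.
Proof.
move=> gZ t; rewrite -[g t]lfunE memv_preim; apply/subvP: t.
apply: (bispan_subv (f := @tens K U V)) => u v Au Bv.
by rewrite -memv_preim lfunE; exact: gZ.
Qed.

(** Counting generators bounds the dimension from above for A and for a complement of A; together
    the two spans fill U (x) V, so both bounds are attained. *)
Lemma dim_tensv (U V : vectType K) (A : {vspace U}) :
  (\dim (tensv A {:V}) = \dim A * \dim {:V})%N.
Proof.
have le (X : {vspace U}) : (\dim (tensv X {:V}) <= \dim X * \dim {:V})%N.
  exact: dim_bispan.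
apply/eqP; rewrite eqn_leq le /=.
have : (fullv <= tensv A {:V} + tensv A^C {:V})%VS.
  apply/subvP=> t _; rewrite -(tlift_id t); apply: memv_suml => i _.
  apply: memv_suml => j _; apply: memvZ.
  have : (vbasis {:U})`_i \in (A + A^C)%VS by rewrite addv_complf memvf.
  case/memv_addP=> x Ax [y Ay ->].
  have := lin_tensl (vbasis {:V})`_j (@lin_id U) 1 x y.
  rewrite !scale1r => ->.
  by apply: memv_add; apply: mem_tens; rewrite ?memvf.
move/dimvS; rewrite [\dim fullv]dimvf /= dim_matrix.
have := le A^C%VS; rewrite dimv_compl.
have := dimvS (subvf A); have := dimv_add_leqif (tensv A {:V}) (tensv A^C {:V}).
by case; nia.
Qed.

End Linearity.

Ltac lin_step := first
  [ exact: lin_id | assumption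
  | apply: lin_sweedler => ? ? | apply: lin_mull | apply: lin_mulr
  | apply: lin_tensl | apply: lin_tensr | apply: lin_scalel
  | apply: lin_scaler | apply: lin_comp ].
Ltac lin := repeat lin_step.

Section SweedlerCalculus.

Variables (K : fieldType) (H : hopfType K).
Implicit Types (W : lmodType K) (x y : H).

(* Pins the vector space structure of H: products and Sweedler components of  *)
(* H otherwise get convertible but syntactically distinct ones.               *)
Local Notation htens := (@tens K H H).
Local Notation sweedler := (@sweedler K H _).

Lemma linear_sweedler W W' (g : {linear W -> W'}) (f : H -> H -> W) x :
  g (sweedler f x) = sweedler (fun a b : H => g (f a b)) x.
Proof. exact: linear_tlift. Qed.

Lemma sweedlerM W (f : H -> H -> W) x y :
    (forall b, linear (f^~ b)) -> (forall a, linear (f a)) ->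
  sweedler f (x * y)
  = sweedler (fun a b : H => sweedler (fun c d : H => f (a * c) (b * d)) y) x.
Proof.
move=> fl fr; rewrite {1}/sweedler comulM.
pose F : {linear tensor H H -> W} := tlift f.
rewrite -/F (linear_tlift F); apply: eq_tlift => a b.
by rewrite (linear_tlift F); apply: eq_tlift => c d; rewrite [LHS]tlift_tens.
Qed.

Lemma sweedler_coassoc W (g : H -> H -> H -> W) x :
    (forall b c, linear (fun a => g a b c)) ->
    (forall a c, linear (fun b => g a b c)) ->
    (forall a b, linear (g a b)) ->
  sweedler (fun a b : H => sweedler (fun c d : H => g c d b) a) x
  = sweedler (fun a b : H => sweedler (fun c d : H => g a c d) b) x.
Proof.
move=> g1 g2 g3.
pose G : {linear tensor (tensor H H) H -> W} :=
  tlift (fun (t : tensor H H) (b : H) => tlift (fun c d : H => g c d b) t).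
have GE (c d b : H) : G (tens (htens c d) b) = g c d b.
  rewrite [LHS]tlift_tens => [|z|t]; [|exact: linearP|exact: lin_tlift].
  by rewrite [LHS]tlift_tens.
have /(congr1 G) := comulA x; rewrite !(linear_tlift G) => eqG.
apply: etrans (etrans _ eqG) _; apply: eq_tlift => a b;
  by rewrite /sweedler (linear_tlift G); apply: eq_tlift => c d; rewrite GE.
Qed.

Lemma sweedler_counitl W (g : H -> W) x : linear g ->
  sweedler (fun a b : H => (counit a : K) *: g b) x = g x.
Proof.
move=> lg; rewrite -[RHS]/(linear_fun lg x) -[in RHS](counitl x) linear_tlift.
by apply: eq_tlift => a b; rewrite linearZ.
Qed.

Lemma sweedler_counitr W (g : H -> W) x : linear g ->
  sweedler (fun a b : H => (counit b : K) *: g a) x = g x.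
Proof.
move=> lg; rewrite -[RHS]/(linear_fun lg x) -[in RHS](counitr x) linear_tlift.
by apply: eq_tlift => a b; rewrite linearZ.
Qed.

Lemma sweedler_antipoder W (g : H -> W) x : linear g ->
  sweedler (fun a b : H => g (a * antipode b)) x = (counit x : K) *: g 1.
Proof.
move=> lg; rewrite -[g 1]/(linear_fun lg 1) -linearZ -antipoder linear_tlift.
exact: eq_tlift.
Qed.

Lemma sweedler1 W (f : H -> H -> W) :
    (forall b, linear (f^~ b)) -> (forall a, linear (f a)) ->
  sweedler f 1 = f 1 1.
Proof. by move=> fl fr; rewrite /sweedler comul1 tlift_tens. Qed.

Lemma eq_sweedler_coideal W (X : {vspace H}) (f g : H -> H -> W) x :
    comul x \in tensv X {:H} ->
    (forall b, linear (f^~ b)) -> (forall a, linear (f a)) ->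
    (forall b, linear (g^~ b)) -> (forall a, linear (g a)) ->
    {in X, forall a, forall b, f a b = g a b} ->
  sweedler f x = sweedler g x.
Proof.
move=> Dx f1 f2 g1 g2 fg; apply: (eq_tensv _ Dx) => u v Xu _ /=.
by rewrite !tlift_tens ?fg.
Qed.

Lemma mem_sweedler_coideal (W : vectType K) (X : {vspace H}) (Z : {vspace W})
    (f : H -> H -> W) x :
    comul x \in tensv X {:H} ->
    (forall b, linear (f^~ b)) -> (forall a, linear (f a)) ->
    {in X, forall a, forall b, f a b \in Z} ->
  sweedler f x \in Z.
Proof.
move=> Dx f1 f2 fZ; apply: (tensv_img _ Dx) => u v Xu _ /=.
by rewrite tlift_tens ?fZ.
Qed.

(** The canonical Galois map of H, x (x) h |-> x_1 (x) x_2 h. *)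
Definition galois_map : 'End(tensor H H) :=
  linfun (tlift (fun x h => sweedler (fun a b : H => htens a (b * h)) x)).

Lemma galois_map_tens x h :
  galois_map (htens x h) = sweedler (fun a b : H => htens a (b * h)) x.
Proof.
rewrite lfunE /= tlift_tens // => [z|z]; first exact: linearP.
by lin.
Qed.

Definition tens_act (t : tensor H H) (m : H) : tensor H H :=
  tlift (fun u v : H => htens (u * m) v) t.

Lemma tens_act_tens u v m : tens_act (htens u v) m = htens (u * m) v.
Proof. by rewrite /tens_act tlift_tens // => z; lin. Qed.

Lemma tens_actl m : linear (tens_act^~ m).
Proof. exact: linearP. Qed.

Lemma tens_actr t : linear (tens_act t).
Proof. by apply: lin_tlift => a b; lin. Qed.

Lemma tens_act1 t : tens_act t 1 = t.
Proof.
by rewrite -[RHS]tlift_id; apply: eq_tlift => u v; rewrite mulr1.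
Qed.

Lemma tens_actM t x y : tens_act t (x * y) = tens_act (tens_act t x) y.
Proof.
rewrite -[RHS]/(linear_fun (tens_actl y) _) linear_tlift.
by apply: eq_tlift => u v /=; rewrite tens_act_tens mulrA.
Qed.

(** The right side expands to x_1 m_1 (x) x_2 m_2 S(m_3) h, and m_2 S(m_3) collapses to a counit.
    Pulled back along [galois_map], the action on the left factor thus multiplies x by m_1 on the
    right, which right ideals tolerate. *)
Lemma tens_act_galois x h m :
  tens_act (galois_map (htens x h)) m
  = galois_map (sweedler (fun p q : H => htens (x * p) (antipode q * h)) m).
Proof.
rewrite galois_map_tens -[LHS]/(linear_fun (tens_actl m) _) linear_sweedler /=.
rewrite [RHS](linear_sweedler galois_map) /=.
transitivity (sweedler (fun p q : H => sweedler (fun a b : H =>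
    sweedler (fun c d : H => htens (a * c) (b * d * (antipode q * h))) p) x)
  m); last first.
  apply: eq_tlift => p q; rewrite galois_map_tens sweedlerM // => z; lin.
rewrite /sweedler [RHS]tlift_exchange; apply: eq_tlift => a b.
rewrite tens_act_tens -!/(sweedler _ _).
rewrite (sweedler_coassoc (g := fun c d q : H =>
  htens (a * c) (b * d * (antipode q * h)))); try by move=> *; lin.
transitivity (sweedler (fun c e : H =>
    (counit e : K) *: htens (a * c) (b * h)) m).
  by rewrite sweedler_counitr //; lin.
apply: eq_tlift => c e.
have lg : linear (fun y : H => htens (a * c) (b * y * h)) by lin.
rewrite -[htens (a * c) (b * h)](congr1 (fun z => htens _ (z * h)) (mulr1 b)).
rewrite -(sweedler_antipoder e lg); apply: eq_tlift => u v.
by rewrite !mulrA.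
Qed.

(** The map is onto, since u (x) v is the image of 1 (x) v acted on by u and the image is stable;
    equal finite dimensions make it injective. *)
Lemma lker_galois_map : lker galois_map == 0%VS.
Proof.
have full : limg galois_map = fullv.
  apply/eqP; rewrite eqEsubv subvf; apply/subvP=> t _.
  rewrite -(tlift_id t); apply: memv_suml => i _; apply: memv_suml => j _.
  apply: memvZ; set u := _`_i; set v := _`_j.
  have -> : htens u v = tens_act (galois_map (htens 1 v)) u.
    rewrite galois_map_tens sweedler1 ?mul1r ?tens_act_tens ?mul1r // => z; lin.
  by rewrite tens_act_galois memv_img ?memvf.
have := limg_ker_dim galois_map fullv; rewrite full capfv -dimv_eq0.
by move/eqP; rewrite -[X in _ == X]add0n eqn_add2r.
Qed.

End SweedlerCalculus.

(** * Extremal right ideals of a right coideal subalgebra *)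

Lemma ex_max_bounded (T : Type) (P : T -> Prop) (f : T -> nat) (N : nat) :
    (exists x, P x) -> (forall x, P x -> (f x <= N)%N) ->
  exists2 x, P x & forall y, P y -> (f y <= f x)%N.
Proof.
case=> x0 Px0 fN; have [n] := ubnP (N - f x0)%N.
elim: n x0 Px0 => // n IHn x Px le_n.
have [[y [Py lt_xy]]|no] := classic (exists y, P y /\ (f x < f y)%N).
  by apply: (IHn y) => //; have := fN y Py; lia.
exists x => // y Py; rewrite leqNgt; apply/negP=> lt_xy.
by apply: no; exists y.
Qed.

(* The rationals a/c with c <= N are compared through the integers a N!/c.    *)
Lemma ex_max_ratio (T : Type) (P : T -> Prop) (a c : T -> nat) (D N : nat) :
    (exists x, P x) ->
    (forall x, P x -> (a x <= D)%N) -> (forall x, P x -> (0 < c x <= N)%N) ->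
  exists2 x, P x & forall y, P y ->
    (a y * c x <= a x * c y)%N /\
    ((a y * c x = a x * c y)%N -> (c y <= c x)%N).
Proof.
move=> exP aD cN; pose q x := (N`! %/ c x)%N.
have qE x : P x -> (q x * c x = N`!)%N.
  by move=> Px; rewrite divnK // dvdn_fact // cN.
have N0 := fact_gt0 N.
(* The weight N+1 exceeds every c x, so this objective orders by the ratio first and breaks ties by
   the larger c. *)
have [|x Px xmax] := @ex_max_bounded T P
    (fun x => a x * q x * N.+1 + c x)%N (D * N`! * N.+1 + N)%N exP.
  move=> x Px; have := cN x Px; have := aD x Px.
  have : (q x <= N`!)%N by apply: leq_div.
  move=> qN aDx /andP[_ cx]; apply: leq_add => //.
  by rewrite leq_mul2r leq_mul ?orbT.
exists x => // y Py; have := xmax y Py; have := cN x Px; have := cN y Py.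
move=> /andP[cy cyN] /andP[cx cxN] le_yx.
have le_A : (a y * q y <= a x * q x)%N.
  rewrite leqNgt; apply/negP=> lt_A.
  have : ((a x * q x).+1 * N.+1 <= a y * q y * N.+1)%N.
    by rewrite leq_mul2r lt_A.
  by lia.
have e1 : (a y * c x * N`! = a y * q y * (c x * c y))%N.
  by rewrite -(qE y Py); lia.
have e2 : (a x * c y * N`! = a x * q x * (c x * c y))%N.
  by rewrite -(qE x Px); lia.
split=> [|eq_ac].
  by rewrite -(leq_pmul2r N0) e1 e2 leq_mul2r le_A orbT.
have : (a y * q y = a x * q x)%N.
  apply/eqP; rewrite -(eqn_pmul2r (_ : 0 < c x * c y)%N) ?muln_gt0 ?cx //.
  by rewrite -e1 -e2 eq_ac.
by move=> eqA; move: le_yx; rewrite eqA; lia.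
Qed.

Section CoidealSubalgebra.

Variables (K : fieldType) (H : hopfType K) (B : {vspace H}).
Hypothesis rcB : right_coideal_subalgebra B.

Local Notation htens := (@tens K H H).
Local Notation htensv := (@tensv K H H).
Local Notation dm := (@dimv K H).
Local Notation d := (dm {: H}).

Definition augmentation : {vspace H} := (B :&: lker (linfun (@counit K H)))%VS.

Lemma mem_augmentation b :
  (b \in augmentation) = (b \in B) && (counit b == 0).
Proof. by rewrite memv_cap memv_ker lfunE. Qed.

Let B1 : 1 \in B. Proof. by case: rcB. Qed.
Let BM : {in B &, forall x y, x * y \in B}. Proof. by case: rcB. Qed.
Let BD : {in B, forall x, comul x \in htensv B {:H}}.
Proof. by case: rcB. Qed.

Lemma mem_mulH (Q : {vspace H}) x h : x \in Q -> x * h \in mulH Q.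
Proof.
move=> Qx; apply: (mem_bispan (@mulr_linearl K H) (@mulr_linearr K H)) => //.
exact: memvf.
Qed.

Lemma mulH_subv (Q Z : {vspace H}) :
  {in Q, forall x, forall h, x * h \in Z} -> (mulH Q <= Z)%VS.
Proof. by move=> QZ; apply: bispan_subv => x h Qx _; apply: QZ. Qed.

Lemma mulHS (Q Q' : {vspace H}) : (Q <= Q')%VS -> (mulH Q <= mulH Q')%VS.
Proof.
by move=> /subvP QQ'; apply: mulH_subv => x Qx h; rewrite mem_mulH ?QQ'.
Qed.

Lemma mulH_full (Q : {vspace H}) : 1 \in mulH Q -> mulH Q = fullv.
Proof.
move=> Q1; apply/eqP; rewrite eqEsubv subvf; apply/subvP=> h _.
rewrite -[h]mul1r; apply: (subvP _ _ (mem_mulH h Q1)).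
apply: mulH_subv => y Qy k; pose g := linear_fun (@mulr_linearl K H k).
rewrite -[y * k]/(g y) -[g y]lfunE memv_preim.
move: y Qy; apply/subvP.
by apply: mulH_subv => x Qx l; rewrite -memv_preim lfunE /= -mulrA mem_mulH.
Qed.

Lemma augmentation_ideal : right_ideal B augmentation.
Proof.
split=> [|x b]; first exact: capvSl.
rewrite !mem_augmentation => /andP[Bx /eqP ex] Bb.
by rewrite BM // counitM ex mul0r eqxx.
Qed.

Lemma dim_augmentation : (dm B = (dm augmentation).+1)%N.
Proof.
have BE : B = (augmentation + <[1]>)%VS.
  apply/eqP; rewrite eqEsubv andbC subv_add -memvE B1 andbT capvSl /=.
  apply/subvP=> b Bb; rewrite -[b](subrK ((counit b : K) *: (1 : H))).
  rewrite memv_add ?memvZ ?memv_line // mem_augmentation.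
  rewrite memvB ?memvZ //= linearB linearZ /= counit1 [_ *: _]mulr1 subrr.
  by rewrite eqxx.
rewrite {1}BE dimv_disjoint_sum ?dim_vline ?oner_eq0 ?addn1 //.
apply/eqP; rewrite -subv0; apply/subvP=> x /memv_capP[].
rewrite mem_augmentation => /andP[_ /eqP ex] /vlineP[k xE].
move: ex; rewrite xE linearZ /= counit1 [_ *: _]mulr1 => ->.
by rewrite scale0r mem0v.
Qed.

Lemma mulH_augmentation_counit : {in mulH augmentation, forall x, counit x = 0}.
Proof.
move=> x; have -> : counit x = linfun (@counit K H) x by rewrite lfunE.
move=> Qx; apply/eqP; rewrite -memv_ker; move: x Qx.
apply/subvP/mulH_subv => x; rewrite mem_augmentation => /andP[_ /eqP ex] h.
by rewrite memv_ker lfunE /= counitM ex mul0r.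
Qed.

Section GaloisImage.

Variable R : {vspace H}.
Hypothesis idR : right_ideal B R.

Local Notation X0 := (galois_map H @: htensv R {:H})%VS.

(** By [tens_act_galois], b sends x (x) h to x b_1 (x) S(b_2) h before the Galois map, and b_1 stays
    in B. *)
Lemma galois_image_stable : act_stable B (@tens_act K H) X0.
Proof.
move=> _ b /memv_imgP[t Rt ->] Bb; move: t Rt.
pose g := linear_fun (tens_actl b) \o galois_map H : {linear _ -> _}.
apply: (tensv_img (g := g)) => x h Rx _ /=.
rewrite tens_act_galois memv_img //.
apply: (mem_sweedler_coideal (BD Bb)) => [q|p|p Bp q]; try by lin.
by apply: mem_tens; rewrite ?memvf //; case: idR => _; apply.
Qed.

Lemma dim_galois_image : \dim X0 = (dm R * d)%N.
Proof.
rewrite limg_dim_eq ?dim_tensv //.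
by rewrite (eqP (lker_galois_map H)) capv0.
Qed.

(** By [tens_act_galois], X0 H lies in the Galois image of RH (x) H. *)
Lemma dim_actH_galois_image :
  (\dim (bispan (@tens_act K H) X0 {:H}) <= dm (mulH R) * d)%N.
Proof.
rewrite -(dim_tensv H (mulH R)).
apply: leq_trans (_ : _ <= \dim (galois_map H @: htensv (mulH R) {:H}))%N _;
  last first.
  by rewrite -(limg_ker_dim (galois_map H) (htensv _ _)) leq_addl.
apply/dimvS/bispan_subv => _ m /memv_imgP[t Rt ->] _; move: t Rt.
pose g := linear_fun (tens_actl m) \o galois_map H : {linear _ -> _}.
apply: (tensv_img (g := g)) => x h Rx _ /=.
rewrite tens_act_galois memv_img //.
have Dm : comul m \in htensv {:H} {:H}.
  rewrite -[comul m]tlift_id; apply: memv_suml => i _; apply: memv_suml => j _.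
  by rewrite memvZ // mem_tens ?memvf.
apply: (mem_sweedler_coideal Dm) => [q|p|p _ q]; try by lin.
by apply: mem_tens; rewrite ?memvf ?mem_mulH.
Qed.

Lemma galois_image_subv : (X0 <= htensv B {:H})%VS.
Proof.
apply/subvP=> _ /memv_imgP[t Rt ->]; move: t Rt.
apply: (tensv_img (g := galois_map H)) => x h Rx _ /=.
have Bx : x \in B by case: idR => /subvP RB _; apply: RB.
rewrite galois_map_tens.
apply: (mem_sweedler_coideal (BD Bx)) => [q|p|p Bp q]; try by lin.
by apply: mem_tens; rewrite ?memvf.
Qed.

End GaloisImage.

Lemma tensvB_stable : act_stable B (@tens_act K H) (htensv B {:H}).
Proof.
move=> t b Bt Bb; move: t Bt.
apply: (tensv_img (g := linear_fun (tens_actl b))) => x h Bx _ /=.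
by rewrite tens_act_tens; apply: mem_tens; rewrite ?memvf ?BM.
Qed.

Lemma actH_tensvB : bispan (@tens_act K H) (htensv B {:H}) {:H} = fullv.
Proof.
apply/eqP; rewrite eqEsubv subvf; apply/subvP=> t _.
rewrite -[t]tlift_id; apply: memv_suml => i _; apply: memv_suml => j _.
apply: memvZ; set u := _`_i; set v := _`_j.
have -> : htens u v = tens_act (htens 1 v) u by rewrite tens_act_tens mul1r.
apply: (mem_bispan (@tens_actl K H) (@tens_actr K H)); rewrite ?memvf //.
by apply: mem_tens; rewrite ?memvf.
Qed.

Lemma right_idealD (R Q : {vspace H}) : right_ideal B R -> right_ideal B Q ->
  right_ideal B (R + Q)%VS.
Proof.
case=> RB RM [QB QM]; split=> [|_ b /memv_addP[x Rx [y Qy ->]] Bb].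
  by rewrite subv_add RB.
by rewrite mulrDl memv_add ?RM ?QM.
Qed.

Lemma right_idealI (R Q : {vspace H}) : right_ideal B R -> right_ideal B Q ->
  right_ideal B (R :&: Q)%VS.
Proof.
case=> RB RM [QB QM]; split=> [|x b /memv_capP[Rx Qx] Bb].
  exact: subv_trans (capvSl _ _) RB.
by rewrite memv_cap RM ?QM.
Qed.

Lemma mulH_B : mulH B = fullv.
Proof. by apply: mulH_full; rewrite -[1]mulr1 mem_mulH. Qed.

Section Ratio.

Variables a c : nat.
Hypothesis ratioP : forall Q, right_ideal B Q ->
  (c * d + a * dm Q <= a * dm B + c * dm (mulH Q))%N.

(** The rank bound in the module H, from the zero subspace up to Q. *)
Lemma ratio_ideal_bound Q : right_ideal B Q ->
  (c * dm (mulH Q) <= a * dm Q)%N.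
Proof.
case=> QB QM.
have := relative_rank_bound BM ratioP (@mulr_linearl K H) (@mulr_linearr K H)
  (@mulr1 H) (@mulrA H) B1 (X0 := 0%VS) (X := Q).
have -> : bispan ( *%R : H -> H -> H) 0 {:H} = 0%VS.
  apply/eqP; rewrite -subv0; apply: bispan_subv => x h.
  by rewrite memv0 => /eqP-> _; rewrite mul0r mem0v.
rewrite !dimv0 !muln0 !addn0; apply=> //; last exact: sub0v.
by move=> x b; rewrite memv0 => /eqP-> _; rewrite mul0r mem0v.
Qed.

Lemma ratio_tens_bound (X0 X : {vspace tensor H H}) :
    act_stable B (@tens_act K H) X0 -> act_stable B (@tens_act K H) X ->
    (X0 <= X)%VS ->
  (c * \dim (bispan (@tens_act K H) X {:H}) + a * \dim X0
   <= a * \dim X + c * \dim (bispan (@tens_act K H) X0 {:H}))%N.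
Proof.
exact: (relative_rank_bound BM ratioP (@tens_actl K H) (@tens_actr K H)
  (@tens_act1 K H) (@tens_actM K H) B1).
Qed.

Definition galois_transporter (R : {vspace H}) (h : H) : {vspace H} :=
  transporter B (@tens_actr K H) (galois_map H @: htensv R {:H})%VS (htens 1 h).

(** The reverse of [ratioP] for the transporter. From X0 to B (x) H the codimensions are cd for the
    spaces and at least ad for the spans, so the rank bound is attained; it must then be attained on
    the first step, from X0 to X1, since it also holds from X1 to B (x) H. *)
Lemma ratio_transporter (R : {vspace H}) (h : H) : right_ideal B R ->
    (dm R + c = dm B)%N -> (dm (mulH R) + a = d)%N ->
  (a * dm B + c * dm (mulH (galois_transporter R h))
   <= c * d + a * dm (galois_transporter R h))%N.
Proof.
move=> idR cE aE; set Q := galois_transporter R h.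
set X0 := (galois_map H @: htensv R {:H})%VS.
set X1 := (X0 + orbit_map (@tens_actr K H) (htens 1 h) @: B)%VS.
have s0 : act_stable B (@tens_act K H) X0 by apply: galois_image_stable.
have s1 : act_stable B (@tens_act K H) X1.
  exact: (add_orbit_stable BM (@tens_actl K H) (@tens_actM K H) s0).
have X1B : (X1 <= htensv B {:H})%VS.
  rewrite subv_add galois_image_subv //=; apply/subvP=> _ /memv_imgP[b Bb ->].
  by rewrite orbit_mapE tens_act_tens mul1r; apply: mem_tens; rewrite ?memvf.
have := ratio_tens_bound s1 tensvB_stable X1B.
have e1 : (\dim X1 + dm Q = dm R * d + dm B)%N.
  by rewrite -dim_galois_image; apply: dim_add_orbit.
have e2 : (\dim (bispan (@tens_act K H) X1 {:H}) + dm (mulH Q)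
           <= dm (mulH R) * d + d)%N.
  apply: leq_trans (_ : _ <= \dim (bispan (@tens_act K H) X0 {:H}) + d)%N _.
    exact: (dim_actH_add_orbit B (@tens_actl K H) (@tens_actr K H)
              (@tens_actM K H)).
  by rewrite leq_add2r dim_actH_galois_image.
have -> : \dim (htensv B {:H}) = (dm B * d)%N by apply: dim_tensv.
rewrite actH_tensvB [\dim fullv]dimvf /= dim_matrix.
move: e1 e2; rewrite -!/d; clearbody Q; move: (\dim X1) (\dim (bispan _ _ _)).
move: (dm Q) (dm (mulH Q)) cE aE; move: (dm R) (dm (mulH R)) (dm B) d.
move=> r rh b dd q qh <- <- x y e1 e2.
have := congr1 (muln a) e1.
have : (c * (y + qh) <= c * (rh * (rh + a) + (rh + a)))%N.
  by rewrite leq_mul2l e2 orbT.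
by lia.
Qed.

End Ratio.

Lemma dim_mulH_augmentation_lt : (dm (mulH augmentation) < d)%N.
Proof.
rewrite ltnNge; apply/negP=> le_d.
have augE : mulH augmentation = fullv by apply/eqP; rewrite eqEdim subvf.
have := @mulH_augmentation_counit 1; rewrite augE => /(_ (memvf _))/eqP.
by rewrite counit1 oner_eq0.
Qed.

(* If R <> 0, the counit does not vanish on R, and RH contains                *)
(* x_1 S(x_2) = eps(x) 1 for x in R.                                          *)
Lemma costable_ideal (R : {vspace H}) :
    {in R, forall x, comul x \in htensv R {:H}} ->
  R = 0%VS \/ mulH R = fullv.
Proof.
move=> RD; have [R0|/eqP nzR] := eqVneq R 0%VS; [by left | right].
apply: mulH_full; have [x Rx ex] : exists2 x, x \in R & counit x != 0.
  apply: NNPP => no; apply: nzR; apply/eqP; rewrite -subv0.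
  apply/subvP=> x Rx; rewrite -[x](counitl x).
  apply: (mem_sweedler_coideal (RD x Rx)) => [b|a|a Ra b]; try by lin.
  have -> : counit a = 0.
    by apply: NNPP => ea; apply: no; exists a => //; apply/eqP.
  by rewrite scale0r mem0v.
rewrite -[1](scalerK ex) memvZ //.
rewrite -[_ *: 1](antipoder x).
apply: (mem_sweedler_coideal (RD x Rx)) => [b|a|a Ra b]; try by lin.
exact: mem_mulH.
Qed.

Theorem dim_right_ideal_mulH (Q : {vspace H}) : right_ideal B Q ->
  (d * dm Q <= dm B * dm (mulH Q))%N.
Proof.
pose a (Q : {vspace H}) := (d - dm (mulH Q))%N.
pose c (Q : {vspace H}) := (dm B - dm Q)%N.
have aE (S : {vspace H}) : (dm (mulH S) + a S = d)%N.
  by rewrite subnKC // dimvS ?subvf.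
have [|||R [idR ltR] Rmax] := @ex_max_ratio _
    (fun Q => right_ideal B Q /\ dm Q < dm B)%N a c d (dm B).
- exists augmentation; split; first exact: augmentation_ideal.
  by rewrite dim_augmentation.
- by move=> S _; apply: leq_subr.
- by move=> S [_ ltS]; rewrite subn_gt0 ltS leq_subr.
have cE (S : {vspace H}) : right_ideal B S -> (dm S + c S = dm B)%N.
  by case=> SB _; rewrite subnKC // dimvS.
clearbody a c.
have ratioP S : right_ideal B S ->
    (c R * d + a R * dm S <= a R * dm B + c R * dm (mulH S))%N.
  move=> idS; case: (ltnP (dm S) (dm B)) => [ltS|leS].
    have [le _] := Rmax S (conj idS ltS).
    have /(congr1 (muln (c R))) := aE S.
    have /(congr1 (muln (a R))) := cE S idS.
    by rewrite !mulnDr; lia.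
  have -> : S = B by apply/eqP; rewrite eqEdim leS; case: idS => ->.
  by rewrite mulH_B addnC.
(* B^+H is proper, so B^+ has positive ratio, and hence so has the maximizer R. *)
have aR : (0 < a R)%N.
  have ltA : (dm augmentation < dm B)%N by rewrite dim_augmentation.
  have [le _] := Rmax _ (conj augmentation_ideal ltA).
  have : (0 < a augmentation)%N.
    by have := aE augmentation; have := dim_mulH_augmentation_lt; lia.
  have : (0 < c R)%N by have := cE R idR; lia.
  by case: (a R) le => // le; move: le; rewrite mul0n leqn0 muln_eq0; lia.
(* The defect in [ratioP] is nonnegative, and it is zero for R and T. The dimension of QH is
   submodular in Q, so the defects of R + T and of I, the intersection of R and T, sum to at most
   zero. Thus I attains the maximal ratio, and the tie-break gives dim R <= dim I. *)
have subT h : (R <= galois_transporter R h)%VS.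
  set T := galois_transporter R h.
  have idT : right_ideal B T.
    apply: (transporter_ideal BM (@tens_actr K H) (@tens_actM K H)).
    exact: galois_image_stable.
  have := ratio_transporter ratioP h idR (cE _ idR) (aE R).
  rewrite -/T => geT.
  pose I : {vspace H} := @capv K H R T; pose U : {vspace H} := @addv K H R T.
  have idI : right_ideal B I by apply: right_idealI.
  have idU : right_ideal B U by apply: right_idealD.
  have ltI : (dm I < dm B)%N by exact: leq_ltn_trans (dimvS (capvSl _ _)) ltR.
  have dimD : (dm U + dm I = dm R + dm T)%N by exact: dimv_sum_cap.
  have dim_mulHD : (dm (mulH U) + dm (mulH I) <= dm (mulH R) + dm (mulH T))%N.
    rewrite -[in leqRHS]dimv_sum_cap; apply: leq_add; apply: dimvS.
      apply: mulH_subv => _ /memv_addP[x Rx [y Ty ->]] h'.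
      by rewrite mulrDl memv_add ?mem_mulH.
    by rewrite subv_cap !mulHS ?capvSl ?capvSr.
  have eqI : (a I * c R = a R * c I)%N.
    have [le _] := Rmax _ (conj idI ltI); apply/eqP; rewrite eqn_leq le /=.
    have := ratioP _ idU; have /(congr1 (muln (a R))) := dimD.
    have : (c R * (dm (mulH U) + dm (mulH I))
            <= c R * (dm (mulH R) + dm (mulH T)))%N.
      by rewrite leq_mul2l dim_mulHD orbT.
    have /(congr1 (muln (c R))) := aE I.
    have /(congr1 (muln (a R))) := cE I idI.
    have /(congr1 (muln (c R))) := aE R.
    have /(congr1 (muln (a R))) := cE R idR.
    by move: geT; rewrite !mulnDr; clear; lia.
  have [_ /(_ eqI) le_c] := Rmax _ (conj idI ltI).
  have le_dim : (dm R <= dm I)%N by have := cE I idI; have := cE R idR; lia.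
  have -> : R = I by apply/esym/eqP; rewrite eqEdim capvSl.
  exact: capvSr.
have RD : {in R, forall x, comul x \in htensv R {:H}}.
  (* Since (1 (x) h) x = x (x) h, [subT] puts R (x) H inside its own Galois image, of the same
     dimension; and [comul x] is the image of x (x) 1. *)
  have X0E : (galois_map H @: htensv R {:H} = htensv R {:H})%VS.
    apply/esym/eqP; rewrite eqEdim dim_galois_image dim_tensv leqnn andbT.
    apply: (bispan_subv (f := htens)) => x h Rx _.
    move/subvP: (subT h) => /(_ x Rx); rewrite mem_transporter => /andP[_].
    by rewrite tens_act_tens mul1r.
  move=> x Rx; rewrite -X0E.
  have -> : comul x = galois_map H (htens x 1).
    rewrite galois_map_tens -[LHS]tlift_id; apply: eq_tlift => u v.
    by rewrite mulr1.
  by apply: memv_img; apply: mem_tens; rewrite ?memvf.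
(* If R = 0, then [a R] = dim H and [c R] = dim B, and [ratioP] is the claim up to a common summand.
   If RH = H, then [a R] = 0, against [aR]. *)
case: (costable_ideal RD) => R0.
  move=> /ratioP.
  have mulH0 : mulH 0%VS = 0%VS :> {vspace H}.
    apply/eqP; rewrite -subv0; apply: mulH_subv => x.
    by rewrite memv0 => /eqP-> h; rewrite mul0r mem0v.
  have := aE R; have := cE R idR; rewrite R0 mulH0 !dimv0 !add0n => <- <-.
  by rewrite mulnC leq_add2l.
have dimR : dm (mulH R) = d by rewrite R0.
by have := aE R; lia.
Qed.

(** By [dim_right_ideal_mulH], a = dim H and c = dim B are admissible in [ratio_ideal_bound], which
    for B^+ reads dim B * dim B^+H <= dim H * (dim B - 1). *)
Lemma dim_mulH_augmentation :
  (d + dm B * dm (mulH augmentation) <= dm B * d)%N.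
Proof.
have ratioP Q : right_ideal B Q ->
    (dm B * d + d * dm Q <= d * dm B + dm B * dm (mulH Q))%N.
  by move=> idQ; rewrite mulnC leq_add2l dim_right_ideal_mulH.
have := ratio_ideal_bound ratioP augmentation_ideal.
have -> : dm B = (dm augmentation).+1 by exact: dim_augmentation.
by lia.
Qed.

End CoidealSubalgebra.

(** With d = dim H and w = dim B^+H = dim A^+H < d, the two inequalities give dim A (d - w) <= d <=
    dim B (d - w). *)
Lemma eq_coideal_subalgebra (K : fieldType) (H : hopfType K)
    (B A : {vspace H}) :
    right_coideal_subalgebra B -> right_coideal_subalgebra A -> (B <= A)%VS ->
    (mulH (augmentation A) <= mulH (augmentation B))%VS ->
  B = A.
Proof.
move=> rcB rcA BA sub.
have mulHE : mulH (augmentation A) = mulH (augmentation B).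
  apply/eqP; rewrite eqEsubv sub mulHS // capvS //.
have ltB := dim_mulH_augmentation_lt B.
have leB := dim_mulH_augmentation rcB.
have leA := dim_right_ideal_mulH rcA (augmentation_ideal rcA).
have dA := dim_augmentation rcA.
apply/eqP; rewrite eqEdim BA; move: leA leB ltB; rewrite mulHE dA.
set w := @dimv K H (mulH _); set d := @dimv K H fullv.
set a := @dimv K H (augmentation A); set b := @dimv K H B.
by move=> leA leB ltw; nia.
Qed.

(** * Partial actions and integrals *)

Section PartialActions.

Variables (K : fieldType) (H : hopfType K) (lam : dual H).

Local Notation htens := (@tens K H H).
Local Notation htensv := (@tensv K H H).
Local Notation sweedler := (@sweedler K H _).

Definition smash_map (h : H) : H :=
  sweedler (fun a b : H => (lam a : K) *: b) h.

Lemma smash_map_linear : linear smash_map.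
Proof. exact: linearP. Qed.

Lemma smash_mapE (W : lmodType K) (g : H -> W) h : linear g ->
  g (smash_map h) = sweedler (fun a b : H => (lam a : K) *: g b) h.
Proof.
move=> lg; rewrite -[LHS]/(linear_fun lg _) linear_tlift.
by apply: eq_tlift => a b; rewrite linearZ.
Qed.

Lemma mem_smash h : smash_map h \in partial_smash lam.
Proof. by apply/partial_smashP; exists h. Qed.

Lemma counit_smash_map h : counit (smash_map h) = lam h.
Proof.
rewrite (smash_mapE h (g := @counit K H)); last exact: linearP.
rewrite -[RHS](sweedler_counitr h (g := lam)); last exact: linearP.
by apply: eq_tlift => a b; rewrite [RHS]mulrC.
Qed.

(** Hence the integral condition on psi only concerns its values on H_lam. *)
Lemma dual_mul_smash (psi : dual H) h : (lam * psi) h = psi (smash_map h).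
Proof. by rewrite dual_mulE (smash_mapE h (g := psi)) //; exact: linearP. Qed.

Definition translate (phi : dual H) (k : H) : dual H :=
  linfun (linear_fun (lin_comp phi (@mulr_linearl K H k))).

Lemma translateE phi k h : translate phi k h = phi (h * k).
Proof. exact: lfunE. Qed.

Lemma translate_rH (B : {vspace H}) phi k :
  phi \in rH B -> translate phi k \in rH B.
Proof.
move=> /mem_rH phiB; apply/mem_rH => b Bb h.
by rewrite !translateE -mulrA phiB.
Qed.

Section FromPartialAction.

Hypothesis plam : partial_action lam.

Lemma lam_smash_mul h k : lam (smash_map h * k) = lam h * lam k.
Proof.
case: plam => _ ->.
by rewrite (smash_mapE h (g := fun x => lam (x * k))) //; lin.
Qed.

Lemma partial_action_integral :
  normalized_right_integral (rH (partial_smash lam)) lam.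
Proof.
split; last by case: plam.
  apply/mem_rH => _ /partial_smashP[h ->] k; rewrite -!/(smash_map h).
  by rewrite lam_smash_mul counit_smash_map.
move=> psi /mem_rH psiB; apply/lfunP=> h.
rewrite dual_mul_smash scale_lfunE -[smash_map h]mulr1 psiB ?mem_smash //.
by rewrite counit_smash_map [RHS]mulrC.
Qed.

(** By the partial action law lam(h_1) lam(k_1) h_2 k_2 = lam(h_1) lam(h_2 k_1) h_3 k_2, which is
    the right side expanded. *)
Lemma smash_mapM h k : smash_map h * smash_map k = smash_map (smash_map h * k).
Proof.
pose g (c e b : H) : H :=
  sweedler (fun p q : H => (lam c * lam (e * p) : K) *: (b * q)) k.
transitivity (sweedler (fun a b : H => sweedler (fun c e : H => g c e b) a) h).
  have -> : smash_map h * smash_map k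
      = sweedler (fun a b : H => (lam a : K) *: (b * smash_map k)) h.
    by rewrite (smash_mapE h (g := fun x => x * smash_map k)) //; lin.
  apply: eq_tlift => a b; rewrite /g [RHS]tlift_exchange.
  rewrite (smash_mapE k (g := fun x => b * x)); last by lin.
  rewrite tliftZ; apply: eq_tlift => p q; case: plam => _ lamM.
  rewrite scalerA [lam a * lam p]lamM -!/(sweedler _ _).
  pose s : {linear K^o -> H} := linear_fun (lin_scalel (b * q) (@lin_id _ K^o)).
  by rewrite -[LHS]/(s _) linear_sweedler.
rewrite sweedler_coassoc; last first.
- move=> a b; apply: lin_sweedler => p q; lin.
- move=> a c; apply: lin_sweedler => p q; apply: lin_scalel; lin.
- move=> b c; apply: lin_sweedler => p q; apply: lin_scalel; lin.
rewrite (smash_mapE h (g := fun x => smash_map (x * k))); last first.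
  by move=> l u v; rewrite mulr_linearl smash_map_linear.
apply: eq_tlift => a b; rewrite /smash_map sweedlerM; first last.
- by move=> ?; lin.
- by move=> ?; lin.
rewrite tliftZ; apply: eq_tlift => c e; rewrite tliftZ; apply: eq_tlift => p q.
by rewrite scalerA.
Qed.

(** The coideal property is coassociativity: lam(h_1) h_2 (x) h_3 is [smash_map] of h_1, tensored
    with h_2. *)
Lemma smash_coideal_subalgebra : right_coideal_subalgebra (partial_smash lam).
Proof.
split.
- have -> : 1 = smash_map 1.
    rewrite /smash_map sweedler1; try by move=> ?; lin.
    by case: plam => -> _; rewrite scale1r.
  exact: mem_smash.
- move=> _ _ /partial_smashP[h ->] /partial_smashP[k ->].
  by rewrite -!/(smash_map _) smash_mapM mem_smash.
move=> _ /partial_smashP[h ->]; rewrite -/(smash_map h).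
rewrite (smash_mapE h (g := @comul K H)); last exact: linearP.
have -> : sweedler (fun a b : H => (lam a : K) *: comul b) h
    = sweedler (fun a b : H => htens (smash_map a) b) h.
  transitivity (sweedler (fun a b : H =>
      sweedler (fun c e : H => (lam a : K) *: htens c e) b) h).
    by apply: eq_tlift => a b; rewrite -[in LHS](tlift_id (comul b)) tliftZ.
  rewrite -(sweedler_coassoc (g := fun a c e => (lam a : K) *: htens c e));
    try by move=> *; lin.
  apply: eq_tlift => a b.
  by rewrite (smash_mapE a (g := fun x => htens x b)) //; lin.
apply: memv_suml => i _; apply: memv_suml => j _; apply: memvZ.
by apply: mem_tens; rewrite ?memvf ?mem_smash.
Qed.

End FromPartialAction.

Section FromIntegral.

Variable B : {vspace H}.
Hypothesis rcB : right_coideal_subalgebra B.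
Hypothesis int_lam : normalized_right_integral (rH B) lam.

Lemma lam1 : lam 1 = 1. Proof. by case: int_lam. Qed.

(** The integral property for the translate psi(-k), evaluated at h. Taking psi = lam gives the
    partial action law. *)
Lemma integral_smash (psi : dual H) h k : psi \in rH B ->
  psi (smash_map h * k) = psi k * lam h.
Proof.
case: int_lam => _ /(_ (translate psi k)) int_psi _ /translate_rH psiB.
have /lfunP/(_ h) := int_psi (psiB k).
by rewrite dual_mul_smash translateE scale_lfunE /dual_counit translateE mul1r.
Qed.

Lemma integral_partial_action : partial_action lam.
Proof.
split=> [|h k]; first exact: lam1.
rewrite mulrC -integral_smash; last by case: int_lam.
by rewrite (smash_mapE h (g := fun x => lam (x * k))) //; lin.
Qed.

(** For b in B the leg b_1 stays in B, so lam(b_1) = eps(b_1) lam(1) = eps(b_1), and [smash_map]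
    fixes b. *)
Lemma integral_sub_smash : (B <= partial_smash lam)%VS.
Proof.
apply/subvP=> b Bb; suff -> : b = smash_map b by apply: mem_smash.
rewrite -{1}[b](sweedler_counitl b (g := id)) //.
case: int_lam rcB => lamB _ _ [_ _ BD].
apply: (eq_sweedler_coideal (BD b Bb)) => [c|a|c|a|a Ba c]; try by lin.
by rewrite -[a in lam a]mulr1 (proj1 (mem_rH _ _) lamB) // lam1 mulr1.
Qed.

(** A functional vanishing on B^+H lies in [rH B], because b - eps(b) 1 is in B^+ for b in B. If
    lam(h) = 0, [integral_smash] makes every such functional vanish on [smash_map h * k], so this
    product lies in B^+H. *)
Lemma augmentation_smash_sub :
  (mulH (augmentation (partial_smash lam)) <= mulH (augmentation B))%VS.
Proof.
apply: mulH_subv => x; rewrite mem_augmentation => /andP[/partial_smashP[h ->]].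
rewrite -/(smash_map h) counit_smash_map => /eqP lam_h k.
have [//|/functional_separation[phi phiB]] := boolP (_ \in _).
have phi_rH : (linfun phi : dual H) \in rH B.
  apply/mem_rH => b Bb y; rewrite !lfunE /=.
  have: phi ((b - (counit b : K) *: (1 : H)) * y) = 0.
    apply: phiB; apply: mem_mulH; rewrite mem_augmentation.
    case: rcB => B1 _ _; rewrite memvB ?memvZ //= linearB linearZ /= counit1.
    by rewrite [_ *: _]mulr1 subrr.
  rewrite mulrBl linearB -scalerAl mul1r linearZ /= => /eqP.
  by rewrite subr_eq0 => /eqP.
have := integral_smash h k phi_rH; rewrite !lfunE /= => ->.
by rewrite lam_h mulr0 eqxx.
Qed.

Lemma integral_smashE : B = partial_smash lam.
Proof.
apply: eq_coideal_subalgebra => //.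
- exact: smash_coideal_subalgebra integral_partial_action.
- exact: integral_sub_smash.
exact: augmentation_smash_sub.
Qed.

End FromIntegral.

End PartialActions.

(** * Integrals in semisimple algebras with a character *)

Section Semisimple.

Variables (K : fieldType) (aT : falgType K) (A : {vspace aT}).
Hypothesis ssA : semisimple_subalgebra A.

Lemma left_idealP (I : {vspace aT}) :
  left_ideal A I <-> (I <= A)%VS /\ {in A & I, forall x y, x * y \in I}.
Proof. by split=> -[IA] => [/prodvP|/prodvP] AI; split. Qed.

Lemma left_idealD (I J : {vspace aT}) :
  left_ideal A I -> left_ideal A J -> left_ideal A (I + J)%VS.
Proof.
move=> [IA AI] [JA AJ]; split; first by rewrite subv_add IA.
by rewrite prodvDr addvS.
Qed.

Lemma left_idealI (I J : {vspace aT}) :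
  left_ideal A I -> left_ideal A J -> left_ideal A (I :&: J)%VS.
Proof.
move=> /left_idealP[IA AI] /left_idealP[JA AJ]; apply/left_idealP; split.
  exact: subv_trans (capvSl _ _) IA.
by move=> x y Ax /memv_capP[Iy Jy]; rewrite memv_cap AI ?AJ.
Qed.

(** A left ideal L of largest dimension meeting N in 0 works: a simple summand not inside N + L
    meets it in 0, and adding it to L would contradict maximality. *)
Lemma semisimple_complement (N : {vspace aT}) : left_ideal A N ->
  exists L, [/\ left_ideal A L, (N :&: L = 0)%VS & (A <= N + L)%VS].
Proof.
move=> idN; have [n [I [simpleI _ AE]]] := ssA.
have [||L [idL NL] Lmax] := @ex_max_bounded _
    (fun L => left_ideal A L /\ (N :&: L = 0)%VS) (fun L => \dim L) (\dim A).
- exists 0%VS; rewrite capv0; split=> //.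
  by split; rewrite ?sub0v // prodv0.
- by move=> L [[LA _] _]; apply: dimvS.
exists L; split=> //; rewrite AE; apply/subv_sumP => i _.
have [idI nzI minI] := simpleI i.
have [cap0|<-] := minI _ (left_idealI idI (left_idealD idN idL)) (capvSl _ _).
  have le_dim : (\dim (L + I i) <= \dim L)%N.
    apply: Lmax; split; first exact: left_idealD.
    apply/eqP; rewrite -subv0; apply/subvP=> x.
    case/memv_capP=> Nx /memv_addP[l Ll [y Iy xE]].
    have y0 : y = 0.
      apply/eqP; rewrite -memv0 -cap0 memv_cap Iy.
      by rewrite -[y](addKr l) -xE addrC memv_add ?memvN.
    by rewrite -NL memv_cap Nx xE y0 addr0.
  have LI : (L + I i = L)%VS by apply/esym/eqP; rewrite eqEdim addvSl.
  case: nzI; rewrite -cap0; apply/esym/capv_idPl.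
  by apply: subv_trans (addvSr _ _); rewrite -LI addvSr.
exact: capvSr.
Qed.

Variable eps : {linear aT -> K^o}.
Hypothesis A1 : 1 \in A.
Hypothesis AM : {in A &, forall x y, x * y \in A}.
Hypothesis eps1 : eps 1 = 1.
Hypothesis epsM : {in A &, forall x y, eps (x * y) = eps x * eps y}.

(* A complement of the augmentation ideal P is spanned by a left integral e.  *)
(* Then eP is a left ideal with square zero, hence zero, and e is also a      *)
(* right integral.                                                            *)
Lemma semisimple_right_integral :
  exists2 e, e \in A & eps e = 1 /\ {in A, forall x, e * x = (eps x : K) *: e}.
Proof.
pose P := (A :&: lker (linfun eps))%VS.
have PE x : (x \in P) = (x \in A) && (eps x == 0).
  by rewrite memv_cap memv_ker lfunE.
have subP x : x \in A -> x - (eps x : K) *: 1 \in P.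
  move=> Ax; rewrite PE memvB ?memvZ //= linearB linearZ /= eps1.
  by rewrite [_ *: _]mulr1 subrr.
have idP : left_ideal A P.
  apply/left_idealP; split=> [|x y Ax]; first exact: capvSl.
  by rewrite !PE => /andP[Ay /eqP ey]; rewrite AM // epsM // ey mulr0 eqxx.
have [L [idL PL sumL]] := semisimple_complement idP.
have /memv_addP[p Pp [e Le oneE]] := subvP sumL _ A1.
have Ap : p \in A by move: Pp; rewrite PE => /andP[].
have /left_idealP[/subvP LA AL] := idL.
have Ae : e \in A by apply: LA.
have ee : eps e = 1.
  have := congr1 eps oneE; rewrite linearD eps1 /=.
  by move: Pp; rewrite PE => /andP[_ /eqP->]; rewrite add0r.
have eps_e x : x \in A -> x * e = (eps x : K) *: e.
  move=> Ax; apply/eqP; rewrite -subr_eq0 -memv0 -PL memv_cap.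
  rewrite [X in _ && X]memvB ?memvZ ?AL // andbT PE memvB ?memvZ ?AM //=.
  by rewrite linearB linearZ epsM //= ee [_ *: _]mulr1 mulr1 subrr.
pose f := linfun (linear_fun (@mulr_linearr K aT e)).
have fE y : f y = e * y by rewrite lfunE.
have idN : left_ideal A (f @: P)%VS.
  apply/left_idealP; split=> [|x _ Ax /memv_imgP[y Py ->]].
    apply/subvP=> z /memv_imgP[y]; rewrite PE => /andP[Ay _] ->.
    by rewrite fE AM.
  rewrite fE mulrA eps_e // -scalerAl memvZ //.
  by rewrite -fE memv_img.
have [M [idM NM sumM]] := semisimple_complement idN.
have /memv_addP[_ /memv_imgP[q Pq ->] [l Ml]] := subvP sumM _ A1.
rewrite fE => one_ql.
(* From 1 = eq + l follows ey = (ey)(eq) + (ey)l. The first term vanishes because ye = eps(y) e = 0,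
   so ey lies in both eP and M. *)
have eP0 y : y \in P -> e * y = 0.
  move=> Py; have /andP[Ay /eqP ey] : (y \in A) && (eps y == 0) by rewrite -PE.
  apply/eqP; rewrite -memv0 -NM memv_cap; apply/andP; split.
    by rewrite -fE memv_img.
  rewrite -[e * y]mulr1 one_ql mulrDr -mulrA [y * _]mulrA eps_e // ey scale0r.
  by rewrite mul0r mulr0 add0r; case/left_idealP: idM => _; apply; rewrite ?AM.
exists e => //; split=> // x Ax.
have /eP0/eqP := subP x Ax.
by rewrite mulrBr -scalerAr mulr1 subr_eq0 => /eqP.
Qed.

End Semisimple.

Section Dual.

Variables (K : fieldType) (H : hopfType K).

Lemma dual_counit_linear : linear (@dual_counit K H : dual H -> K^o).
Proof. by move=> k u v; rewrite /dual_counit add_lfunE scale_lfunE. Qed.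

Lemma dual_counitM (phi psi : dual H) :
  dual_counit (phi * psi) = dual_counit phi * dual_counit psi.
Proof.
rewrite /dual_counit dual_mulE sweedler1 // => z k u v.
  by rewrite linearP mulrDl scalerAl.
by rewrite linearP mulrDr scalerAr.
Qed.

Lemma semisimple_normalized_integral (B : {vspace H}) :
    right_coideal_subalgebra B -> semisimple_subalgebra (rH B) ->
  exists lam, normalized_right_integral (rH B) lam.
Proof.
move=> rcB ssB; have [A1 AM] := rH_subalgebra rcB.
have [||e Ae [ee int_e]] := semisimple_right_integral ssB
  (eps := linear_fun dual_counit_linear) A1 AM.
- by rewrite /= /dual_counit dual_oneE counit1.
- by move=> x y _ _; exact: dual_counitM.
by exists e; split.
Qed.

End Dual.

Theorem theorem5p11 (K : closedFieldType) (charK0 : [pchar K]%R =i pred0)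
    (H : hopfType K) (B : {vspace H}) (rcB : right_coideal_subalgebra B) :
  ((exists lam : dual H, partial_action lam /\ B = partial_smash lam) <->
   (exists lam : dual H, normalized_right_integral (rH B) lam)) /\
  (semisimple_subalgebra (rH B) ->
   exists lam : dual H, partial_action lam /\ B = partial_smash lam).
Proof.
have from_integral : (exists lam, normalized_right_integral (rH B) lam) ->
    exists lam : dual H, partial_action lam /\ B = partial_smash lam.
  case=> lam int_lam; exists lam; split.
    exact: (integral_partial_action int_lam).
  exact: (integral_smashE rcB int_lam).
split; first split=> // -[lam [plam ->]].
  by exists lam; apply: partial_action_integral.
by move=> ssB; apply: from_integral; apply: semisimple_normalized_integral.
Qed.
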